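(* Let $K$ be a field and let $I=\langle m_0,\ldots,m_n\rangle\subset K[x,y]$ be an $\langle x,y\rangle$-primary monomial ideal, where $m_i=x^{a_i}y^{b_i}$ for $i=0,\ldots,n$, with $0=a_0<a_1<\cdots<a_n$ and $b_0>b_1>\cdots>b_n=0$. Suppose that $m_i\in I(a_n,b_0)$ for all $i=0,\ldots,n$, where $I(a_n,b_0)$ is the integral closure of the ideal $\langle x^{a_n},y^{b_0}\rangle$. Then $$\widetilde{I}=I_S\cap I_T ,$$ where $\widetilde I$ is the Ratliff-Rush closure of $I$ and the monomial ideals $I_S$, $I_T$ are defined from the exponents $(a_i,b_i)$ as in the context.
   Context: For a regular ideal $I$ (one containing a nonzerodivisor) of a commutative Noetherian ring $R$, the Ratliff-Rush closure of $I$ is $\widetilde{I}=\bigcup_{l\ge 1}(I^{l+1}:I^{l})$, where $I^{l+1}:I^l=\{z\in R\mid zI^l\subseteq I^{l+1}\}$. For positive integers $a,b$, $I(a,b)$ denotes the integral closure of the ideal $\langle x^a,y^b\rangle$ in $K[x,y]$. The integral closure of an ideal $J$ of $R$ is the set of $z\in R$ satisfying an equation $z^k+c_1z^{k-1}+\cdots+c_k=0$ with $c_i\in J^i$. Given the exponents $(a_i,b_i)$, $i=0,\ldots,n$, let $\Omega=\{\sum_{i=0}^n\lambda_i(a_i,b_i)\mid \lambda_i\in\mathbb{Z}_{\ge 0}\}$, and let $$S=\{(\alpha,\beta)\in\mathbb{Z}_{\ge0}^2\setminus\{(0,0)\}\mid \alpha\le a_n,\ \beta\le b_0,\ (\alpha,\beta+kb_0)\in\Omega\text{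 for some }k\in\mathbb{Z}_{\ge0}\},$$ $$T=\{(\alpha,\beta)\in\mathbb{Z}_{\ge0}^2\setminus\{(0,0)\}\mid \alpha\le a_n,\ \beta\le b_0,\ (\alpha+ka_n,\beta)\in\Omega\text{ for some }k\in\mathbb{Z}_{\ge0}\}.$$ Set $I_S=\langle x^\alpha y^\beta\mid(\alpha,\beta)\in S\rangle$ and $I_T=\langle x^\alpha y^\beta\mid(\alpha,\beta)\in T\rangle$, ideals of $K[x,y]$. *)

(* Defs.v *)
From mathcomp Require Import all_boot all_algebra.
From mathcomp Require Import mpoly.
From mathcomp Require Import boolp classical_sets.
Set Implicit Arguments.
Unset Strict Implicit.
Unset Printing Implicit Defensive.
Import GRing.Theory.

Local Open Scope ring_scope.
Local Open Scope classical_set_scope.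

Section Ideals.
Variable R : comNzRingType.
Implicit Types (I J P : set R) (l : nat).

(* The ideals of ring_quotient are proper and have a boolean membership
   predicate; here ideals are arbitrary classical subsets, R included. *)
Definition is_ideal I : Prop :=
  [/\ I 0,
      forall u v, I u -> I v -> I (u + v)
    & forall r u, I u -> I (r * u)].

Definition ideal_gen (A : set R) : set R := smallest is_ideal A.

Definition ideal_mul I J : set R :=
  ideal_gen [set z | exists u v, [/\ I u, J v & z = u * v]].

Definition ideal_exp I l : set R := iter l (ideal_mul I) setT.

Definition colon I J : set R := [set z | forall w, J w -> I (z * w)].

Definition radical I : set R := [set z | exists l, I (z ^+ l)].

Definition is_primary I : Prop :=
  [/\ is_ideal I, ~ I 1
    & forall u v, I (u * v) -> I u \/ exists l, I (v ^+ l)].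

Definition is_primary_to P I : Prop := is_primary I /\ radical I = P.

Definition integral_closure J : set R :=
  [set z | exists (k : nat) (c : nat -> R),
     [/\ (0 < k)%N,
         forall i, (1 <= i <= k)%N -> ideal_exp J i (c i)
       & z ^+ k + \sum_(1 <= i < k.+1) c i * z ^+ (k - i) = 0]].

(* Used for regular ideals; an <x, y>-primary ideal is one, since it contains a
   power of x. *)
Definition ratliff_rush I : set R :=
  \bigcup_(l >= 1) colon (ideal_exp I l.+1) (ideal_exp I l).

End Ideals.

Section PlaneMonomials.
Variable K : fieldType.

Definition varx : {mpoly K[2]} := 'X_ord0.
Definition vary : {mpoly K[2]} := 'X_ord_max.

Definition mon (alpha beta : nat) : {mpoly K[2]} := varx ^+ alpha * vary ^+ beta.

Definition mon_ideal (E : set (nat * nat)) : set {mpoly K[2]} :=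
  ideal_gen [set mon e.1 e.2 | e in E].

Definition ideal_xy : set {mpoly K[2]} := ideal_gen [set varx; vary].

Definition Iab (p q : nat) : set {mpoly K[2]} :=
  integral_closure (ideal_gen [set varx ^+ p; vary ^+ q]).

End PlaneMonomials.

Arguments mon_ideal K E _ : clear implicits.
Arguments ideal_xy K _ : clear implicits.
Arguments Iab K p q _ : clear implicits.

Section Exponents.
Variables (n : nat) (a b : 'I_n.+1 -> nat).

Definition Omega : set (nat * nat) :=
  [set e | exists lam : 'I_n.+1 -> nat,
     e = ((\sum_i lam i * a i)%N, (\sum_i lam i * b i)%N)].

Definition expS : set (nat * nat) :=
  [set e | [/\ e != (0, 0)%N, (e.1 <= a ord_max)%N, (e.2 <= b ord0)%N
    & exists k : nat, Omega (e.1, (e.2 + k * b ord0)%N)]].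

Definition expT : set (nat * nat) :=
  [set e | [/\ e != (0, 0)%N, (e.1 <= a ord_max)%N, (e.2 <= b ord0)%N
    & exists k : nat, Omega ((e.1 + k * a ord_max)%N, e.2)]].

End Exponents.

(* Main.v *)
Require Import Defs.
From mathcomp Require Import all_boot all_algebra.
From mathcomp Require Import mpoly.
From mathcomp Require Import boolp classical_sets.
From mathcomp Require Import zify.
Set Implicit Arguments.
Unset Strict Implicit.
Unset Printing Implicit Defensive.
Import GRing.Theory.
Local Open Scope ring_scope.
Local Open Scope classical_set_scope.

(** Write p = a_n and q = b_0, so that x^p and y^q are the last and the first
    generator.  Membership in a monomial ideal is tested on the monomials of the
    support ([mon_ideal_support]), and the powers of a monomial ideal are the
    monomial ideals of the iterated sumsets ([mon_ideal_exp]).  The theorem thus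
    becomes a statement about exponents: the monomial of exponent e lies in the
    Ratliff-Rush closure of I when, for some l, the sum of e with any sum of l
    generators dominates a sum of l + 1 generators.

    The hypothesis on the integral closure says that every generator lies on or
    above the segment from (p, 0) to (0, q), i.e. that its weight q * a + p * b
    is at least p * q ([Iab_weight]).

    Closure inside I_S and I_T ([colon_reduced]).  Multiply the monomial
    of exponent (alpha, beta) by y^(l * q), which is in I^l.  The result is
    divisible by the product of l + 1 generators, of exponent (A, B) say, and
    A <= alpha, B <= beta + l * q.  If p <= alpha, the monomial is a multiple of
    x^p.  Otherwise A < p, and since (A, B) has weight at least
    (l + 1) * (p * q), B exceeds l * q; so lowering B by a suitable multiple of q
    gives an element of S below (alpha, beta).  I_T is the mirror image.

    I_S and I_T inside the closure ([expS_expT_dominates]).  If (x, y) is in S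
    with (x, y + k * q) a sum of generators, the number of these generators is at
    least k + 1, because the second coordinate of a generator is at most q, with
    equality only for (0, q) ([wsize_gt]).  Hence multiplication by the monomial of exponent
    (x, y) sends y^(k * q) into I^(k + 1).  An element of T does the same for some
    x^(k' * p).  Finally (x^p, y^q) is a reduction of I: in a product of many
    generators, each generator repeated p * q times may be replaced by p * q
    copies of x^p and y^q in all, whose product divides the one replaced
    ([pure_power_reduction]).  So for large l every product of l generators is
    divisible by a product of l generators containing y^(k * q) or x^(k' * p), and
    multiplication by a monomial in both I_S and I_T sends it into I^(l + 1). *)

(** * Monomial ideals and their exponents *)

Definition dominates (E : set (nat * nat)) : set (nat * nat) :=
  [set e | exists2 u, E u & (u.1 <= e.1)%N && (u.2 <= e.2)%N].

Definition sumset (A B : set (nat * nat)) : set (nat * nat) :=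
  [set e | exists u v, [/\ A u, B v & e = (u.1 + v.1, u.2 + v.2)%N]].

Definition iter_sumset (E : set (nat * nat)) (l : nat) : set (nat * nat) :=
  iter l (sumset E) [set (0, 0)%N].

Definition mexp (m : 'X_{1..2}) : nat * nat := (m ord0, m ord_max).

Definition mnm_of (e : nat * nat) : 'X_{1..2} :=
  (U_(ord0) *+ e.1 + U_(ord_max) *+ e.2)%MM.

Lemma mnm_ofK : cancel mnm_of mexp.
Proof.
case=> x y; rewrite /mexp /mnm_of !mnmDE !mulmnE !mnm1E /=.
by rewrite ?mul1n ?mul0n ?addn0 ?add0n.
Qed.

Lemma mexpK : cancel mexp mnm_of.
Proof.
move=> m; apply/mnmP => i; rewrite /mexp /mnm_of !mnmDE !mulmnE !mnm1E /=.
case: i => [[|[|//]] hi] /=; rewrite ?mul1n ?mul0n ?addn0 ?add0n;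
  by congr (m _); apply: val_inj.
Qed.

Lemma mexpD m1 m2 :
  mexp (m1 + m2)%MM = ((mexp m1).1 + (mexp m2).1, (mexp m1).2 + (mexp m2).2)%N.
Proof. by rewrite /mexp !mnmDE. Qed.

Lemma dominates_trans (A B : set (nat * nat)) :
  A `<=` dominates B -> dominates A `<=` dominates B.
Proof.
move=> AB e [u Au /andP[u1 u2]]; have [v Bv /andP[v1 v2]] := AB _ Au.
by exists v => //; rewrite (leq_trans v1 u1) (leq_trans v2 u2).
Qed.

Lemma dominates_up (E : set (nat * nat)) (e f : nat * nat) :
  (e.1 <= f.1)%N -> (e.2 <= f.2)%N -> dominates E e -> dominates E f.
Proof.
move=> h1 h2 [u Eu /andP[u1 u2]]; exists u => //.
by rewrite (leq_trans u1 h1) (leq_trans u2 h2).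
Qed.

Section MonomialIdeals.
Variable K : fieldType.
Implicit Types (E A B : set (nat * nat)) (f g : {mpoly K[2]}).

Lemma mon_mpolyX e : mon K e.1 e.2 = 'X_[mnm_of e].
Proof. by rewrite /mon /varx /vary !mpolyXn -mpolyXD. Qed.

Lemma ideal_gen_ideal (R : comNzRingType) (A : set R) : is_ideal (ideal_gen A).
Proof.
split=> [J [[]] //|u v Au Av J hJ|r u Au J hJ].
- by case: (hJ) => -[_ hD _] _; apply: hD; [apply: Au|apply: Av].
- by case: (hJ) => -[_ _ hM] _; apply: hM; apply: Au.
Qed.

Lemma ideal_sum (R : comNzRingType) (J : set R) (T : eqType) (s : seq T)
    (F : T -> R) :
  is_ideal J -> (forall t, t \in s -> J (F t)) -> J (\sum_(t <- s) F t).
Proof.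
case=> J0 JD _ JF; rewrite big_seq.
by apply: big_ind => // t; apply: JF.
Qed.

(** Polynomials all of whose monomials dominate an element of E form an ideal, so
    cancellation between multiples of generators cannot produce new monomials. *)
Lemma mon_ideal_support E f :
  mon_ideal K E f <-> forall m, m \in msupp f -> dominates E (mexp m).
Proof.
split.
  have gens : [set mon K e.1 e.2 | e in E] `<=`
      [set f | forall m, m \in msupp f -> dominates E (mexp m)].
    move=> _ [e Ee <-] m; rewrite mon_mpolyX msuppX inE => /eqP ->.
    by rewrite mnm_ofK; exists e => //; rewrite !leqnn.
  move: f; apply: (smallest_sub _ gens); split.
  - by move=> m; rewrite msupp0.
  - move=> u v hu hv m /msuppD_le; rewrite mem_cat => /orP[]; [exact: hu|exact: hv].
  - move=> r u hu m /msuppM_le /allpairsP [[m1 m2] /= [_ h2 ->]].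
    move: (hu _ h2); apply: dominates_up; rewrite mexpD; exact: leq_addl.
move=> hf; rewrite (mpolyE f).
apply: ideal_sum; first exact: ideal_gen_ideal.
move=> m /hf [e Ee /andP[e1 e2]].
have [_ _ idM] := @ideal_gen_ideal _ [set mon K e.1 e.2 | e in E].
have le_em : (mnm_of e <= m)%MM.
  rewrite -(mexpK m); apply/mnm_lepP => i.
  by rewrite /mnm_of !mnmDE !mulmnE leq_add // leq_mul.
rewrite -(submK le_em) mpolyXD -mon_mpolyX scalerAl.
by apply: idM; apply: sub_gen_smallest; exists e.
Qed.

Lemma mon_ideal_mul A B :
  ideal_mul (mon_ideal K A) (mon_ideal K B) = mon_ideal K (sumset A B).
Proof.
apply/seteqP; split.
  apply: smallest_sub; first exact: ideal_gen_ideal.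
  move=> _ [f [g [/mon_ideal_support hf /mon_ideal_support hg ->]]].
  apply/mon_ideal_support => m /msuppM_le /allpairsP [[m1 m2] /= [/hf + /hg + ->]].
  case=> u Au /andP[u1 u2] [v Bv /andP[v1 v2]].
  exists (u.1 + v.1, u.2 + v.2)%N; first by exists u, v.
  by rewrite mexpD !leq_add.
apply: smallest_sub; first exact: ideal_gen_ideal.
move=> _ [_ [u [v [Au Bv ->]]] <-]; apply: sub_gen_smallest.
exists (mon K u.1 u.2), (mon K v.1 v.2); split.
- by apply: sub_gen_smallest; exists u.
- by apply: sub_gen_smallest; exists v.
- by rewrite /mon /= !exprD mulrACA.
Qed.

(** For l = 0 both sides are the whole ring: the empty sum is (0, 0), which
    everything dominates. *)
Lemma mon_ideal_exp E l :
  ideal_exp (mon_ideal K E) l = mon_ideal K (iter_sumset E l).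
Proof.
elim: l => [|l IHl]; last by rewrite /ideal_exp iterS -/(ideal_exp _ _) IHl mon_ideal_mul.
apply/seteqP; split=> f // _; apply/mon_ideal_support => m _.
by exists (0, 0)%N.
Qed.

(** * The integral closure of <x^p, y^q> *)

(** The weight q * x + p * y is additive and equals p * q at both generators. *)
Lemma iter_sumset_weight p q l e :
  iter_sumset [set (p, 0); (0, q)]%N l e -> (l * (p * q) <= q * e.1 + p * e.2)%N.
Proof.
elim: l e => [|l IHl] e; first by move=> ->; rewrite mul0n.
move=> [u [v [uE /IHl hv ->]]] /=; rewrite mulSn.
have hu : (p * q <= q * u.1 + p * u.2)%N by case: uE => -> /=; lia.
by rewrite !mulnDr; lia.
Qed.

Lemma ideal_xp_yq p q :
  ideal_gen [set varx K ^+ p; vary K ^+ q] = mon_ideal K [set (p, 0); (0, q)]%N.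
Proof.
congr ideal_gen; apply/seteqP; split=> f.
- by case=> ->; [exists (p, 0)%N; [left|] | exists (0, q)%N; [right|]];
    rewrite // /mon ?expr0 ?mulr1 ?mul1r.
- by case=> e [] -> <-; [left|right]; rewrite /mon /= ?mulr1 ?mul1r.
Qed.

(** Let z be a monomial of weight w < p * q and z^k + c_1 z^(k-1) + ... + c_k = 0
    an equation of integral dependence.  Every monomial of c_i has weight at least
    i * (p * q) > i * w, so no c_i z^(k-i) contains the monomial z^k, which
    therefore cannot cancel. *)
Lemma Iab_weight p q e : Iab K p q (mon K e.1 e.2) -> (p * q <= q * e.1 + p * e.2)%N.
Proof.
rewrite /Iab /integral_closure ideal_xp_yq mon_mpolyX => -[k [c [k0 hc eqz]]].
rewrite leqNgt; apply/negP => lt_e.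
(* Compare the coefficients of z^k. *)
move: eqz => /(congr1 (mcoeff (mnm_of e *+ k)%MM)).
rewrite mcoeffD raddf_sum /= mcoeff0 mpolyXn mcoeffX eqxx big_nat_cond big1 ?addr0.
  by move/eqP; rewrite oner_eq0.
move=> i; rewrite andbT => /andP[i1 ik].
have -> : (mnm_of e *+ k = mnm_of e *+ (k - i) + mnm_of e *+ i)%MM.
  by apply/mnmP => j; rewrite mnmDE !mulmnE -mulnDr subnK.
rewrite mpolyXn mcoeffMX; apply: memN_msupp_eq0; apply/negP => hm.
have := hc i; rewrite i1 ltnS in ik *; move/(_ ik).
rewrite mon_ideal_exp => /mon_ideal_support/(_ _ hm) [u /iter_sumset_weight hu].
have := mnm_ofK e; case: e lt_e {k0 hc k ik c hm} => x y /= lt_e [ex ey].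
rewrite /mexp !mulmnE ex ey /= => /andP[u1 u2].
have : (q * u.1 + p * u.2 <= i * (q * x + p * y))%N.
  by rewrite mulnDr; apply: leq_add; rewrite mulnCA leq_mul // mulnC.
have : (i * (q * x + p * y) < i * (p * q))%N by rewrite ltn_pmul2l.
lia.
Qed.
End MonomialIdeals.

(** * Sums of exponents *)

Section Generators.
Variable J : finType.
Implicit Types (lam mu c a b : J -> nat) (s t : J).

Definition wsum lam c : nat := (\sum_i lam i * c i)%N.

Definition wsize lam : nat := (\sum_i lam i)%N.

Definition single s k : J -> nat := fun i => ((i == s) * k)%N.

Definition addw lam mu : J -> nat := fun i => (lam i + mu i)%N.

Definition pairs a b : set (nat * nat) := [set (a i, b i) | i in [set: J]].

Lemma wsumD lam mu c : wsum (addw lam mu) c = (wsum lam c + wsum mu c)%N.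
Proof. by rewrite /wsum -big_split; apply: eq_bigr => i _; rewrite mulnDl. Qed.

Lemma wsizeD lam mu : wsize (addw lam mu) = (wsize lam + wsize mu)%N.
Proof. by rewrite /wsize -big_split. Qed.

Lemma wsum_single s k c : wsum (single s k) c = (k * c s)%N.
Proof.
rewrite /wsum (bigD1 s) //= big1 ?addn0 => [|i /negPf ne]; rewrite /single.
  by rewrite eqxx mul1n.
by rewrite ne.
Qed.

Lemma wsize_single s k : wsize (single s k) = k.
Proof.
rewrite /wsize (bigD1 s) //= big1 ?addn0 => [|i /negPf ne]; rewrite /single.
  by rewrite eqxx mul1n.
by rewrite ne.
Qed.

Lemma split_single lam s k : (k <= lam s)%N ->
  exists mu, lam = addw (single s k) mu.
Proof.
move=> h; exists (fun i => (lam i - (i == s) * k)%N); apply/funext => i.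
by rewrite /addw /single; case: eqP => [->|_]; lia.
Qed.

Lemma iter_sumset_pairs a b l e :
  iter_sumset (pairs a b) l e <->
  exists2 lam, wsize lam = l & e = (wsum lam a, wsum lam b).
Proof.
elim: l e => [|l IHl] e; split.
- move=> ->; exists (fun=> 0%N); first by rewrite /wsize big1.
  by rewrite /wsum !big1.
- case=> lam /eqP; rewrite /wsize sum_nat_eq0 => /forallP lam0 ->.
  by rewrite /wsum !big1 // => i _; have /eqP -> := lam0 i.
- move=> [_ [v [[i _ <-] /IHl [lam <- ->] ->]]].
  exists (addw (single i 1) lam); first by rewrite wsizeD wsize_single.
  by rewrite !wsumD !wsum_single !mul1n.
- case=> lam lamE ->.
  have [i lam_i] : exists i, (0 < lam i)%N.
    apply/existsP; apply: contra_eqT lamE; rewrite negb_exists => /forallP lam0.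
    by rewrite /wsize big1 // => i _; apply/eqP; have := lam0 i; rewrite -eqn0Ngt.
  have [mu muE] := split_single lam_i; move: lamE; rewrite {}muE => lamE.
  exists (a i, b i), (wsum mu a, wsum mu b); split; first by exists i.
    by apply/IHl; exists mu => //; move: lamE; rewrite wsizeD wsize_single => -[].
  by rewrite !wsumD !wsum_single !mul1n.
Qed.

(** The powers of an ideal decrease: extra generators are simply dropped. *)
Lemma iter_sumset_le E l m : (l <= m)%N ->
  dominates (iter_sumset E m) `<=` dominates (iter_sumset E l).
Proof.
move=> /subnK <-; elim: (m - l)%N => [|k IHk] //=.
move=> e h; apply: IHk; move: e h; apply: dominates_trans.
by move=> _ [u [v [_ hv ->]]]; exists v; rewrite //= !leq_addl.
Qed.

(** Each generator contributes at most q to the second coordinate y + k * q, so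
    mu uses at least k of them.  If it used only k, then y = 0 and each would
    contribute exactly q; such generators have first coordinate 0, so x = 0 too. *)
Lemma wsize_gt q a b mu x y k :
  (forall i, (b i <= q)%N) -> (forall i, b i = q -> a i = 0%N) -> (0 < x + y)%N ->
  x = wsum mu a -> (y + k * q)%N = wsum mu b -> (k < wsize mu)%N.
Proof.
move=> b_le b_max xy_gt0 xE yE; rewrite ltnNge; apply/negP => le_k.
have le_q : (wsum mu b <= wsize mu * q)%N.
  by rewrite /wsum /wsize big_distrl; apply: leq_sum => i _; rewrite leq_mul2l b_le orbT.
have le_kq : (wsize mu * q <= k * q)%N by rewrite leq_mul2r le_k orbT.
have y0 : y = 0%N by lia.
have mub : wsum mu b == (wsize mu * q)%N by lia.
have x0 : x = 0%N.
  rewrite xE /wsum big1 // => i _; apply/eqP; rewrite muln_eq0.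
  apply: contraTT mub => /norP[mu_i a_i]; rewrite neq_ltn; apply/orP; left.
  rewrite /wsum /wsize big_distrl /= (bigD1 i) //= [X in (_ < X)%N](bigD1 i) //=.
  rewrite -addSn; apply: leq_add.
    rewrite ltn_pmul2l ?lt0n // ltn_neqAle b_le andbT.
    by apply: contra_neqN a_i => /eqP/b_max ->.
  by apply: leq_sum => j _; rewrite leq_mul2l b_le orbT.
by lia.
Qed.

(** If z times the k-th power of generator s0 is in I^(k + 1), then z times any
    product of generators that contains this k-th power is in the next power of I:
    the k copies of s0 are exchanged for the generators counted by mu. *)
Lemma replace_pure_power a b lam mu k e f s0 :
  (k <= lam s0)%N -> (k < wsize mu)%N ->
  (wsum mu a <= e.1 + k * a s0)%N -> (wsum mu b <= e.2 + k * b s0)%N ->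
  (wsum lam a <= f.1)%N -> (wsum lam b <= f.2)%N ->
  dominates (iter_sumset (pairs a b) (wsize lam).+1) (e.1 + f.1, e.2 + f.2)%N.
Proof.
move=> /split_single [nu ->]; rewrite !wsumD !wsum_single !wsizeD !wsize_single.
move=> k_mu mu_a mu_b lam_a lam_b.
apply: (@iter_sumset_le _ _ (wsize (addw mu nu))).
  by rewrite wsizeD; lia.
exists (wsum (addw mu nu) a, wsum (addw mu nu) b).
  by apply/iter_sumset_pairs; exists (addw mu nu).
by rewrite !wsumD /=; lia.
Qed.

Section ConvexPosition.
Variables (p q : nat) (a b : J -> nat) (s t : J).
Hypotheses (p_gt0 : (0 < p)%N) (q_gt0 : (0 < q)%N).
Hypothesis weight : forall i, (p * q <= q * a i + p * b i)%N.

Lemma wsum_weight lam : (wsize lam * (p * q) <= q * wsum lam a + p * wsum lam b)%N.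
Proof.
rewrite /wsize /wsum big_distrl !big_distrr -big_split /=; apply: leq_sum => i _.
have -> : (q * (lam i * a i) + p * (lam i * b i) = lam i * (q * a i + p * b i))%N by lia.
by rewrite leq_mul2l weight orbT.
Qed.

(** The pair (x, y) is an element of S below (alpha, beta), obtained from a product
    of l + 1 generators that divides x^alpha y^(beta + l * q).  The roles of the
    coordinates are not tied to an order on the generators, so that exchanging them
    yields the analogue for T. *)
Lemma colon_reduced lam l alpha beta : a t = p -> b t = 0%N ->
  wsize lam = l.+1 -> (wsum lam a <= alpha)%N -> (wsum lam b <= beta + l * q)%N ->
  exists x y, [/\ (x <= alpha)%N, (y <= beta)%N, (0 < x + y)%N, (x <= p)%N & (y <= q)%N]
    /\ exists k mu, x = wsum mu a /\ (y + k * q)%N = wsum mu b.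
Proof.
move=> at_p bt_0 lamE le_a le_b.
(* If p <= alpha, then generator t itself, (p, 0), is below (alpha, beta). *)
have [p_le|lt_p] := leqP p alpha.
  exists p, 0%N; split; first by split => //; rewrite ?addn0.
  by exists 0%N, (single t 1); rewrite !wsum_single at_p bt_0 !mul1n.
have := wsum_weight lam; rewrite lamE mulSn => wlam.
have lt_lq : (l * q < wsum lam b)%N.
  rewrite ltnNge; apply/negP => le_lq.
  have : (q * wsum lam a < p * q)%N by rewrite mulnC ltn_pmul2r //; lia.
  have : (p * wsum lam b <= l * (p * q))%N.
    by rewrite mulnCA leq_pmul2l.
  by lia.
(* The representative of the second coordinate modulo q is taken in 1, .., q
   rather than in 0, .., q - 1, so that it stays nonzero. *)
set B := wsum lam b in lt_lq le_b wlam *.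
pose y := (((B - l * q).-1 %% q).+1)%N.
pose d := ((B - l * q).-1 %/ q)%N.
have By : (B = y + (d + l) * q)%N.
  have := divn_eq (B - l * q).-1 q; rewrite -/d /y mulnDl; lia.
have y_le_q : (y <= q)%N by rewrite /y ltn_mod.
exists (wsum lam a), y; split; first by split=> //; rewrite ?mulnDl /y in By *; lia.
by exists (d + l)%N, lam; rewrite -By.
Qed.

(** The ideal generated by x^p and y^q is a reduction of I: p * q copies of a
    generator (a, b) with q * a + p * b >= p * q are divisible by a product of
    p * q generators all equal to x^p or y^q.  After replacement each generator is
    left with fewer than p * q copies of its own, hence the bound. *)
Lemma pure_power_reduction lam : a s = 0%N -> b s = q -> a t = p -> b t = 0%N ->
  (forall i, (a i <= p)%N) ->
  exists lam' : J -> nat,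
    [/\ wsize lam' = wsize lam, (wsum lam' a <= wsum lam a)%N,
        (wsum lam' b <= wsum lam b)%N &
        (wsize lam <= #|J| * (p * q) + (lam' s + lam' t))%N].
Proof.
move=> as_0 bs_q at_p bt_0 a_le.
pose r i := (lam i %% (p * q))%N; pose d i := (lam i %/ (p * q))%N.
(* p * q copies of generator i are traded for q * a i copies of generator t and
   for as many copies of generator s as keep the total number unchanged. *)
pose V := wsum d (fun i => q * a i)%N.
pose U := wsum d (fun i => p * q - q * a i)%N.
have UV : (wsize r + (U + V) = wsize lam)%N.
  rewrite /U /V /wsum /wsize -!big_split /=; apply: eq_bigr => i _.
  rewrite -mulnDr subnK; last by rewrite mulnC leq_mul2r a_le orbT.
  by rewrite addnC -divn_eq.
have rd c : wsum lam c = (wsum r c + wsum d (fun i => (p * q) * c i))%N.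
  rewrite /wsum -big_split; apply: eq_bigr => i _ /=.
  by rewrite {1}(divn_eq (lam i) (p * q)) mulnDl -mulnA addnC.
exists (addw r (addw (single s U) (single t V))); split.
- by rewrite !wsizeD !wsize_single.
- rewrite !wsumD !wsum_single as_0 muln0 add0n at_p rd leq_add2l.
  rewrite /V /wsum big_distrl; apply: leq_sum => i _ /=; lia.
- rewrite !wsumD !wsum_single bs_q bt_0 muln0 addn0 rd leq_add2l.
  rewrite /U /wsum big_distrl; apply: leq_sum => i _ /=.
  rewrite -mulnA leq_mul2l; apply/orP; right.
  rewrite mulnAC leq_mul2r; apply/orP; right.
  by have := weight i; lia.
- have le_r : (wsize r <= #|J| * (p * q))%N.
    rewrite /wsize -sum_nat_const; apply: leq_sum => i _.
    by rewrite ltnW // ltn_mod muln_gt0 p_gt0.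
  rewrite /addw /single !eqxx; lia.
Qed.

End ConvexPosition.
End Generators.

(** * Ratliff-Rush closures of monomial ideals *)

Lemma colon_mon_ideal (K : fieldType) (A B : set (nat * nat)) (f : {mpoly K[2]}) :
  colon (mon_ideal K A) (mon_ideal K B) f <->
  forall m, m \in msupp f -> forall u, B u ->
    dominates A ((mexp m).1 + u.1, (mexp m).2 + u.2)%N.
Proof.
split=> [fBA m fm u Bu|fBA g /mon_ideal_support gB].
  have /fBA/mon_ideal_support : mon_ideal K B (mon K u.1 u.2).
    by apply: sub_gen_smallest; exists u.
  move/(_ (mnm_of u + m)%MM); rewrite mon_mpolyX mcoeff_msupp mcoeffMX -mcoeff_msupp.
  by rewrite mexpD mnm_ofK addnC [(u.2 + _)%N]addnC; apply.
apply/mon_ideal_support => m /msuppM_le /allpairsP [[m1 m2] /= [/fBA + /gB + ->]].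
move=> fu [u Bu /andP[u1 u2]]; have := fu _ Bu; rewrite mexpD.
by apply: dominates_up; rewrite leq_add2l.
Qed.

(** A polynomial has finitely many monomials, so one exponent l serves them all. *)
Lemma common_threshold (T : eqType) (P : T -> nat -> Prop) (r : seq T) :
  (forall m, m \in r -> exists N, forall l, (N <= l)%N -> P m l) ->
  exists N, forall l, (N <= l)%N -> forall m, m \in r -> P m l.
Proof.
elim: r => [|m r IHr] h; first by exists 0%N.
have [N1 h1] := h m (mem_head _ _).
have [|N2 h2] := IHr; first by move=> m' hm'; apply: h; rewrite inE hm' orbT.
exists (maxn N1 N2) => l; rewrite geq_max => /andP[l1 l2] m'.
by rewrite inE => /orP[/eqP ->|]; [exact: h1|exact: h2].
Qed.

Lemma ratliff_rush_mon_ideal (K : fieldType) (E : set (nat * nat))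
    (f : {mpoly K[2]}) :
  ratliff_rush (mon_ideal K E) f <->
  exists2 l, (1 <= l)%N & forall m, m \in msupp f -> forall u, iter_sumset E l u ->
    dominates (iter_sumset E l.+1) ((mexp m).1 + u.1, (mexp m).2 + u.2)%N.
Proof.
split=> -[l l1 h]; exists l => //; move: h;
  by rewrite !mon_ideal_exp => /colon_mon_ideal.
Qed.

Section RatliffRushExponents.
Variables (n : nat) (a b : 'I_n.+1 -> nat).
Let p := a ord_max.
Let q := b ord0.
Hypotheses (a0 : a ord0 = 0%N) (bn : b ord_max = 0%N).
Hypotheses (p_gt0 : (0 < p)%N) (q_gt0 : (0 < q)%N).
Hypothesis a_mono : forall i j : 'I_n.+1, (i < j)%N -> (a i < a j)%N.
Hypothesis b_mono : forall i j : 'I_n.+1, (i < j)%N -> (b j < b i)%N.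
Hypothesis weight : forall i, (p * q <= q * a i + p * b i)%N.

(* The endpoints of the strictly monotone sequences are strict extrema. *)
Let a_le i : (a i <= p)%N.
Proof.
have [->//|ne] := eqVneq i ord_max; apply/ltnW/a_mono.
by rewrite ltn_neqAle -ltnS ltn_ord andbT.
Qed.

Let b_le i : (b i <= q)%N.
Proof.
have [->//|ne] := eqVneq i ord0; apply/ltnW/b_mono.
by rewrite lt0n.
Qed.

Let b_max i : b i = q -> a i = 0%N.
Proof.
have [->//|ne] := eqVneq i ord0 => bq.
by have := @b_mono ord0 i; rewrite -/q bq ltnn lt0n => /(_ ne).
Qed.

Let a_max i : a i = p -> b i = 0%N.
Proof.
have [->//|ne] := eqVneq i ord_max => ap.
by have := @a_mono i ord_max; rewrite -/p ap ltnn ltn_neqAle -ltnS ltn_ord andbT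
  => /(_ ne).
Qed.

Lemma colon_dominates_expS l e :
  dominates (iter_sumset (pairs a b) l.+1) (e.1, e.2 + l * q)%N ->
  dominates (expS a b) e.
Proof.
case=> _ /iter_sumset_pairs [lam lamE ->] /andP[/= lam_a lam_b].
have [x [y [[xe ye xy xp yq] [k [mu [xE yE]]]]]] :=
  colon_reduced p_gt0 q_gt0 weight (erefl : a ord_max = p) bn lamE lam_a lam_b.
exists (x, y); last by rewrite xe ye.
split=> //; first by apply: contraTneq xy => -[-> ->].
by exists k, mu; rewrite /= yE xE.
Qed.

Lemma colon_dominates_expT l e :
  dominates (iter_sumset (pairs a b) l.+1) (e.1 + l * p, e.2)%N ->
  dominates (expT a b) e.
Proof.
case=> _ /iter_sumset_pairs [lam lamE ->] /andP[/= lam_a lam_b].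
have weight' i : (q * p <= p * b i + q * a i)%N.
  by rewrite addnC mulnC weight.
have [y [x [[ye xe xy yq xp] [k [mu [yE xE]]]]]] :=
  colon_reduced q_gt0 p_gt0 weight' (erefl : b ord0 = q) a0 lamE lam_b lam_a.
exists (x, y); last by rewrite xe ye.
split=> //; first by apply: contraTneq xy => -[-> ->].
by exists k, mu; rewrite /= yE xE.
Qed.

(** By reduction to pure powers, once l is large a product of l generators may be
    assumed to contain k copies of y^q or k' copies of x^p, where k and k' witness
    the membership of divisors of the monomial in S and T. *)
Lemma expS_expT_dominates e :
  dominates (expS a b) e -> dominates (expT a b) e ->
  exists N, forall l, (N <= l)%N -> forall u, iter_sumset (pairs a b) l u ->
    dominates (iter_sumset (pairs a b) l.+1) (e.1 + u.1, e.2 + u.2)%N.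
Proof.
case=> -[x y] [/= xy0 _ _ [k [mu [xE yE]]]] /andP[/= xe ye].
case=> -[x' y'] [/= xy0' _ _ [k' [mu' [xE' yE']]]] /andP[/= xe' ye'].
have pos (c d : nat) : (c, d) != (0, 0)%N -> (0 < c + d)%N.
  by rewrite lt0n addn_eq0; apply: contraNN => /andP[/eqP -> /eqP ->].
have k_mu : (k < wsize mu)%N by apply: (wsize_gt b_le b_max (pos _ _ xy0) xE yE).
have k_mu' : (k' < wsize mu')%N.
  by apply: (wsize_gt a_le a_max _ yE' xE'); rewrite addnC pos.
exists (#|'I_n.+1| * (p * q) + (k + k'))%N => l le_l u /iter_sumset_pairs [lam lamE ->].
have [lam' [lamE' le_a le_b]] :=
  pure_power_reduction p_gt0 q_gt0 weight lam a0 (erefl : b ord0 = q)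
    (erefl : a ord_max = p) bn a_le.
rewrite -lamE in le_l *; move=> le_lam; rewrite -lamE'.
have [le_k|gt_k] := leqP k (lam' ord0).
  apply: (@replace_pure_power _ _ _ _ _ k e (_, _) _ le_k k_mu) => //.
  - by rewrite /wsum -xE a0 muln0 addn0.
  - by rewrite /wsum -yE leq_add2r.
have le_k' : (k' <= lam' ord_max)%N.
  by move: (leq_trans le_l le_lam); rewrite leq_add2l; lia.
apply: (@replace_pure_power _ _ _ _ _ k' e (_, _) _ le_k' k_mu') => //.
- by rewrite /wsum -xE' leq_add2r.
- by rewrite /wsum -yE' bn muln0 addn0.
Qed.

End RatliffRushExponents.

Theorem theorem9 (K : fieldType) (n : nat) (a b : 'I_n.+1 -> nat)
    (I : set {mpoly K[2]})
    (hI : I = ideal_gen [set mon K (a i) (b i) | i in [set: 'I_n.+1]])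
    (hprim : is_primary_to (ideal_xy K) I)
    (ha0 : a ord0 = 0%N)
    (ha : forall i j : 'I_n.+1, (i < j)%N -> (a i < a j)%N)
    (hb : forall i j : 'I_n.+1, (i < j)%N -> (b j < b i)%N)
    (hbn : b ord_max = 0%N)
    (hint : forall i : 'I_n.+1, Iab K (a ord_max) (b ord0) (mon K (a i) (b i))) :
  ratliff_rush I =
    mon_ideal K (expS a b) `&` mon_ideal K (expT a b).
Proof.
have IE : I = mon_ideal K (pairs a b).
  by rewrite hI /mon_ideal /pairs image_comp.
(* A single generator would be 1, and I would not be proper. *)
have n_gt0 : (0 < n)%N.
  rewrite lt0n; apply/eqP => n0; have [[_ nI1 _] _] := hprim; apply: nI1.
  rewrite hI; apply: sub_gen_smallest; exists ord0 => //.
  have -> : b ord0 = 0%N by rewrite -hbn; congr b; apply: val_inj; rewrite /= n0.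
  by rewrite ha0 /mon !expr0 mulr1.
have p_gt0 : (0 < a ord_max)%N by rewrite -ha0; apply: ha.
have q_gt0 : (0 < b ord0)%N by rewrite -hbn; apply: hb.
have weight i : (a ord_max * b ord0 <= b ord0 * a i + a ord_max * b i)%N.
  exact: (@Iab_weight K _ _ (a i, b i) (hint i)).
(* The test elements of I^l are y^(l * q) for S and x^(l * p) for T. *)
have copies i l : iter_sumset (pairs a b) l (l * a i, l * b i)%N.
  apply/iter_sumset_pairs; exists (single i l); first exact: wsize_single.
  by rewrite !wsum_single.
apply/seteqP; split=> f; rewrite IE.
  case/ratliff_rush_mon_ideal => l _ h.
  split; apply/mon_ideal_support => m fm.
  - apply: (@colon_dominates_expS _ a b hbn p_gt0 q_gt0 weight l).
    by have := h m fm _ (copies ord0 l); rewrite /= ha0 muln0 addn0.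
  - apply: (@colon_dominates_expT _ a b ha0 p_gt0 q_gt0 weight l).
    by have := h m fm _ (copies ord_max l); rewrite /= hbn muln0 addn0.
case=> /mon_ideal_support fS /mon_ideal_support fT.
apply/ratliff_rush_mon_ideal.
have [|N hN] := @common_threshold _ (fun m l =>
    forall u, iter_sumset (pairs a b) l u ->
    dominates (iter_sumset (pairs a b) l.+1) ((mexp m).1 + u.1, (mexp m).2 + u.2)%N)
  (msupp f).
  move=> m fm; apply: expS_expT_dominates => //; [exact: fS|exact: fT].
by exists N.+1 => //; apply: hN.
Qed.
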